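(* Let $M$ and $N$ be in $\mathcal{X}$. Let $M':=M\cup\lim(M)$ and $N':=N\cup\lim(N)$, where $\lim(M)$ denotes the set of limit points of $M$ (limit ordinals $\gamma$ with $\sup(M\cap\gamma)=\gamma$), and similarly for $\lim(N)$. Then $M'\cap N'\subseteq\beta_{M,N}$.
   Context: Standing assumptions and notation. Assume $2^{\omega_1}=\omega_2$ and fix a bijection $\pi:\omega_2\to H(\omega_2)$. $P_{\omega_1}(\omega_2)$ is the set of countable subsets of $\omega_2$. Assume there is a stationary set $\mathcal{Y}\subseteq P_{\omega_1}(\omega_2)$ which is thin, i.e. for all $\beta<\omega_2$ the set $\{a\cap\beta: a\in\mathcal{Y}\}$ has size at most $\omega_1$; fix such a $\mathcal{Y}$ which is moreover closed under initial segments ($a\in\mathcal{Y}$, $\beta<\omega_2$ imply $a\cap\beta\in\mathcal{Y}$). Let $\mathcal{A}$ be the structure $(H(\omega_2),\in,\pi,\mathcal{Y})$, which has definable Skolem functions (via the well-ordering induced by $\pi$). For $a\subseteq H(\omega_2)$, $Sk(a)$ is the closure of $a$ under a fixed set of definable Skolem functions for $\mathcal{A}$. Let $C$ be the (club) set of $\beta<\omega_2$ with $Sk(\beta)\cap\omega_2=\beta$, and let $\Lambda$ be the set of $\beta<\omega_2$ of cofinality $\omega_1$ which are limit points of $C$. Let $\mathcal{X}$ be the set of $M\in\mathcal{Y}$ such that $Sk(M)\cap\omega_2=M$ and for all $\gamma\in M$, $\sup(C\cap\gamma)\in M$. Comparison points. Fix a set $\Gamma\subseteq\Lambda$ which is stationary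 in $\omega_2$. For $M\in\mathcal{X}$, $\Gamma_M$ is the set of $\beta\in\Gamma$ such that $\beta=\min(\Gamma\setminus\sup(M\cap\beta))$, i.e. $\Gamma\cap[\sup(M\cap\beta),\beta)=\emptyset$. For $M,N\in\mathcal{X}$, $\Gamma_M\cap\Gamma_N$ has a largest element, denoted $\beta_{M,N}$. *)

(* Defs.v *)
From HB Require Import structures.
From mathcomp Require Import all_boot.
From mathcomp Require Import boolp classical_sets functions cardinality.

Set Implicit Arguments.
Unset Strict Implicit.
Unset Printing Implicit Defensive.

Local Open Scope classical_set_scope.
Local Open Scope card_scope.
Local Open Scope quotient_scope.

(** [V] is Aczel's type of well-founded trees modulo bisimulation, so that
    equality in [V] is Leibniz equality.  Classes and sets of elements of [V]
    are predicates, of type [set V]; [elts x] is the extension of [x]. *)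

Inductive tree : Type := Tree (T : Type) (f : T -> tree).

Fixpoint bisim (s t : tree) : Prop :=
  let: Tree A f := s in let: Tree B g := t in
  (forall i, exists j, bisim (f i) (g j)) /\
  (forall j, exists i, bisim (f i) (g j)).

HB.instance Definition _ := gen_eqMixin tree.
HB.instance Definition _ := gen_choiceMixin tree.

Definition bisimb (s t : tree) : bool := `[< bisim s t >].

Lemma bisimb_refl : reflexive bisimb.
Proof.
move=> s; apply/asboolP; elim: s => T f IH /=.
by split=> i; exists i; apply: IH.
Qed.

Lemma bisimb_sym : symmetric bisimb.
Proof.
suff sym s t : bisim s t -> bisim t s.
  by move=> s t; apply/asboolP/asboolP; apply: sym.
elim: s t => A f IH [B g] /= [fg gf]; split.
- by move=> j; have [i fgij] := gf j; exists i; apply: IH.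
- by move=> i; have [j fgij] := fg i; exists j; apply: IH.
Qed.

Lemma bisimb_trans : transitive bisimb.
Proof.
move=> t s u /asboolP st /asboolP tu; apply/asboolP.
elim: s t u st tu => A f IH [B g] [D h] /= [fg gf] [gh hg]; split.
- move=> i; have [j fgij] := fg i; have [k ghjk] := gh j.
  by exists k; apply: IH fgij ghjk.
- move=> k; have [j ghjk] := hg k; have [i fgij] := gf j.
  by exists i; apply: IH fgij ghjk.
Qed.

Canonical bisim_equiv := EquivRel bisimb bisimb_refl bisimb_sym bisimb_trans.

Definition V := {eq_quot bisimb}.
HB.instance Definition _ := Choice.on V.

Definition vset (T : Type) (f : T -> V) : V :=
  \pi_V (Tree (fun i => repr (f i))).

Definition vempty : V := vset (of_void V).
HB.instance Definition _ := isPointed.Build V vempty.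

Definition elts (x : V) : set V :=
  let: Tree T f := repr x in range (fun i => \pi_V (f i)).

Lemma elts_vset (T : Type) (f : T -> V) : elts (vset f) = range f.
Proof.
rewrite /elts /vset.
have : bisim (repr (\pi_V (Tree (fun i => repr (f i)))))
             (Tree (fun i => repr (f i))).
  by apply/asboolP; apply/(eqmodP bisim_equiv); rewrite reprK.
case: (repr _) => A g /= [gf fg]; apply/seteqP; split=> _ [i _ <-].
- have [j gfij] := gf i; exists j => //.
  rewrite -[f j]reprK; apply/esym/(eqmodP bisim_equiv); exact/asboolP.
- have [j gfij] := fg i; exists j => //.
  rewrite -[f i]reprK; apply/(eqmodP bisim_equiv); exact/asboolP.
Qed.

Lemma extensionality (x y : V) : elts x = elts y -> x = y.
Proof.
rewrite /elts -{2}[x]reprK -{2}[y]reprK.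
case: (repr x) => A f; case: (repr y) => T g /seteqP[fg gf].
apply/(eqmodP bisim_equiv)/asboolP => /=; split.
- move=> i; have [|j _ /(eqmodP bisim_equiv) gfj] := fg (\pi_V (f i)).
    by exists i.
  by exists j; apply/asboolP; rewrite -/(bisimb _ _) bisimb_sym.
- move=> j; have [|i _ /(eqmodP bisim_equiv) fgi] := gf (\pi_V (g j)).
    by exists j.
  by exists i; apply/asboolP.
Qed.

Lemma foundation : well_founded (fun x y : V => elts y x).
Proof.
suff wf t x : bisim (repr x) t -> Acc (fun x y : V => elts y x) x.
  move=> x; apply: (wf (repr x)); exact/asboolP/bisimb_refl.
elim: t x => T g IH x xg; constructor=> y; move: xg.
rewrite /elts; case: (repr x) => A f /= [fg _] [i _ <-].
have [j fgij] := fg i; apply: (IH j); apply/asboolP.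
move/asboolP: fgij; apply: (@bisimb_trans (f i)).
by apply/(eqmodP bisim_equiv); rewrite reprK.
Qed.

Definition transitive_class (A : set V) : Prop :=
  forall x, A x -> elts x `<=` A.

(** By [foundation], membership well-orders [elts a] as soon as it is total. *)
Definition ordinal (a : V) : Prop :=
  transitive_class (elts a) /\
  forall x y, elts a x -> elts a y -> [\/ elts y x, x = y | elts x y].

(** On ordinals, [<=] is inclusion and [<] is membership. *)
Definition ole (a b : V) : Prop := elts a `<=` elts b.

Definition is_least (A : set V) (b : V) : Prop :=
  A b /\ forall x, A x -> ole b x.

Definition is_greatest (A : set V) (b : V) : Prop :=
  A b /\ forall x, A x -> ole x b.

(** Least upper bound of a set of ordinals; in particular [osup set0] is [0]. *)
Definition osup (A : set V) : V :=
  get (is_least [set s | ordinal s /\ forall x, A x -> ole x s]).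

Definition limit_ordinal (a : V) : Prop :=
  [/\ ordinal a, elts a !=set0 &
      forall x, elts a x -> exists2 y, elts a y & elts y x].

Definition lim (A : set V) : set V :=
  [set g | limit_ordinal g /\ osup (A `&` elts g) = g].

(** [omega1] and [omega2] as sets of ordinals: the Hartogs numbers of [omega]
    and of [omega1]. *)
Definition omega1 : set V := [set a | ordinal a /\ countable (elts a)].
Definition omega2 : set V := [set a | ordinal a /\ elts a #<= omega1].

Definition cofinal_in (a : V) (A : set V) : Prop :=
  A `<=` elts a /\ forall x, elts a x -> exists2 y, A y & ole x y.

Definition cofinality_omega1 (a : V) : Prop :=
  (exists2 A, cofinal_in a A & A #= omega1) /\
  forall A, cofinal_in a A -> omega1 #<= A.

Definition club (D : set V) : Prop :=
  [/\ D `<=` omega2,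
      forall a, omega2 a -> exists2 b, D b & elts b a &
      forall g, omega2 g -> lim D g -> D g].

Definition stationary (S : set V) : Prop :=
  forall D, club D -> S `&` D !=set0.

Definition Pomega1 : set (set V) := [set a | a `<=` omega2 /\ countable a].

Definition Pclub (D : set (set V)) : Prop :=
  [/\ D `<=` Pomega1,
      forall a, Pomega1 a -> exists2 b, D b & a `<=` b &
      forall u : nat -> set V, (forall n, D (u n)) ->
        (forall n, u n `<=` u n.+1) -> D (\bigcup_n u n)].

Definition Pstationary (Y : set (set V)) : Prop :=
  Y `<=` Pomega1 /\ forall D, Pclub D -> Y `&` D !=set0.

Definition thin (Y : set (set V)) : Prop :=
  forall b, omega2 b -> [set a `&` elts b | a in Y] #<= omega1.

Definition initial_segment_closed (Y : set (set V)) : Prop :=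
  forall a b, Y a -> omega2 b -> Y (a `&` elts b).

Definition trcl (x : V) : set V := smallest transitive_class (elts x).

Definition card_lt (T U : Type) (A : set T) (B : set U) : Prop :=
  A #<= B /\ ~ (B #<= A).

Definition Homega2 : set V := [set x | card_lt (trcl x) omega2].

(** First-order formulas with free variables among [v_0, ..., v_(n-1)]; in
    [Fex], variable 0 is bound and the others are shifted. *)
Inductive formula : nat -> Type :=
| Feq n (i j : 'I_n) : formula n
| Fin n (i j : 'I_n) : formula n
| Fpi n (i j : 'I_n) : formula n
| FY n (i : 'I_n) : formula n
| Fnot n (p : formula n) : formula n
| Fand n (p q : formula n) : formula n
| Fex n (p : formula n.+1) : formula n.

Definition env_cons n (x : V) (e : 'I_n -> V) (i : 'I_n.+1) : V :=
  if unlift ord0 i is Some j then e j else x.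

(** Satisfaction in the structure (H(omega2), in, pi, Y): [Fpi i j] is the graph
    of [pi], whose domain is [omega2], and [FY i] says that the set [v_i] is a
    member of [Y]. *)
Fixpoint sat (pi : V -> V) (Y : set (set V)) n (p : formula n) :
    ('I_n -> V) -> Prop :=
  match p in formula n return ('I_n -> V) -> Prop with
  | Feq _ i j => fun e => e i = e j
  | Fin _ i j => fun e => elts (e j) (e i)
  | Fpi _ i j => fun e => omega2 (e i) /\ pi (e i) = e j
  | FY _ i => fun e => Y (elts (e i))
  | Fnot _ p => fun e => ~ sat pi Y p e
  | Fand _ p q => fun e => sat pi Y p e /\ sat pi Y q e
  | Fex _ p => fun e => exists2 x, Homega2 x & sat pi Y p (env_cons x e)
  end.

Definition fun_family := forall n : nat, set (('I_n -> V) -> V).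

Definition in_Homega2 n (e : 'I_n -> V) : Prop := forall i, Homega2 (e i).

Definition definable (pi : V -> V) (Y : set (set V)) n (f : ('I_n -> V) -> V) :
    Prop :=
  (forall e, in_Homega2 e -> Homega2 (f e)) /\
  exists p : formula n.+1, forall e x, in_Homega2 e -> Homega2 x ->
    (f e = x <-> sat pi Y p (env_cons x e)).

Definition skolem_function (pi : V -> V) (Y : set (set V)) n
    (p : formula n.+1) (f : ('I_n -> V) -> V) : Prop :=
  forall e, in_Homega2 e ->
    sat pi Y (Fex p) e -> sat pi Y p (env_cons (f e) e).

(** A Skolem function is required for every formula; the functions sending
    parameters to the [pi]-least witness, or to [pi 0] if there is none, form
    one such [F]. *)
Definition definable_skolem_functions (pi : V -> V) (Y : set (set V))
    (F : fun_family) : Prop :=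
  (forall n f, F n f -> definable pi Y f) /\
  (forall n (p : formula n.+1), exists2 f, F n f & skolem_function pi Y p f).

Definition closed_under (F : fun_family) (A : set V) : Prop :=
  forall n f (e : 'I_n -> V), F n f -> (forall i, A (e i)) -> A (f e).

Definition Sk (F : fun_family) (a : set V) : set V :=
  smallest (closed_under F) a.

Definition CC (F : fun_family) : set V :=
  [set b | omega2 b /\ Sk F (elts b) `&` omega2 = elts b].

Definition Lambda (F : fun_family) : set V :=
  [set b | [/\ omega2 b, cofinality_omega1 b & lim (CC F) b]].

Definition XX (F : fun_family) (Y : set (set V)) : set (set V) :=
  [set M | [/\ Y M, Sk F M `&` omega2 = M &
    forall g, M g -> M (osup (CC F `&` elts g))]].

(** [Gamma `\` elts s] is the set of ordinals of [Gamma] that are [>= s]. *)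
Definition Gamma_at (Gamma M : set V) : set V :=
  [set b | Gamma b /\ is_least (Gamma `\` elts (osup (M `&` elts b))) b].

Definition comparison_point (Gamma M N : set V) : V :=
  get (is_greatest (Gamma_at Gamma M `&` Gamma_at Gamma N)).

(* Main.v *)
(** If [g] lies below [min (Gamma \ g)] and [M] either contains [g] or
    accumulates at [g], then [min (Gamma \ g)] is in [Gamma_M].  Applied to a
    common point of [M'] and [N'], this gives an element of [Gamma_M] and
    [Gamma_N] above the point: a limit point of a countable set has countable
    cofinality and so is not in [Gamma], and a point of [M] and [N] that is in
    [Gamma] is replaced by its successor, which [M] and [N] also contain since
    they are closed under Skolem functions.

    The same fact gives the existence of [beta_(M,N)]: if [Gamma_M] and
    [Gamma_N] had no largest common element, then the supremum [g] of the common
    elements would be a limit of [M] and of [N], and [min (Gamma \ g)] would be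
    a largest common element. *)

Require Import Defs.
From mathcomp Require Import all_boot.
From mathcomp Require Import boolp classical_sets functions cardinality.

Local Open Scope classical_set_scope.
Local Open Scope card_scope.
Local Open Scope quotient_scope.

Local Notation ordinal := Defs.ordinal.

(** * Ordinals *)

Lemma elts_minimal (A : set V) :
  A !=set0 -> exists2 m, A m & forall y, elts m y -> ~ A y.
Proof.
case=> x; elim/(well_founded_ind foundation): x => x IH Ax.
have [[y xy Ay]|noA] := pselect (exists2 y, elts x y & A y); first exact: IH Ay.
by exists x => // y xy Ay; apply: noA; exists y.
Qed.

Lemma elts_irr x : ~ elts x x.
Proof.
move=> xx; have [|m -> H] := elts_minimal [set x]; first by exists x.
exact: (H x).
Qed.

Lemma elts_asym x y : elts x y -> ~ elts y x.
Proof.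
move=> xy yx; have [|m [->|->] H] := elts_minimal [set z | z = x \/ z = y].
- by exists x; left.
- by apply: (H y) => //; right.
- by apply: (H x) => //; left.
Qed.

Lemma elts_acyclic3 x y z : elts x y -> elts y z -> ~ elts z x.
Proof.
move=> xy yz zx.
have [|m [->|->|->] H] := elts_minimal [set t | [\/ t = x, t = y | t = z]].
- by exists x; constructor 1.
- by apply: (H y) => //; constructor 2.
- by apply: (H z) => //; constructor 3.
- by apply: (H x) => //; constructor 1.
Qed.

Lemma ordinal_trans {a x y : V} : ordinal a -> elts a x -> elts x y -> elts a y.
Proof. by move=> [tra _] ax; apply: tra. Qed.

(** Transitivity of [x] comes from comparability inside [a]: for [z] in [y] in [x], any placing of
    [z] other than in [x] closes a membership cycle. *)
Lemma ordinal_elt {a x : V} : ordinal a -> elts a x -> ordinal x.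
Proof.
move=> oa ax; split=> [y xy z yz|y z xy xz].
  have az := ordinal_trans oa (ordinal_trans oa ax xy) yz.
  have [//|xz|zx] := oa.2 z x az ax.
    by rewrite xz in yz; case: (elts_asym _ _ xy).
  by case: (elts_acyclic3 _ _ _ xy yz).
by apply: oa.2; apply: (ordinal_trans oa ax).
Qed.

(** Nested induction: if neither ordinal is a member of the other, comparing the elements of each
    with the other shows that their extensions coincide. *)
Lemma ordinal_trichotomy {a b : V} :
  ordinal a -> ordinal b -> [\/ elts b a, a = b | elts a b].
Proof.
elim/(well_founded_ind foundation): a b => a IHa b.
elim/(well_founded_ind foundation): b => b IHb oa ob.
have [|nab] := pselect (elts b a); first by constructor 1.
have [|nba] := pselect (elts a b); first by constructor 3.
constructor 2; apply: Defs.extensionality; apply/seteqP; split=> x xin.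
  have [//|xb|bx] := IHa x xin b (ordinal_elt oa xin) ob.
    by rewrite xb in xin.
  by case: nba; apply: ordinal_trans bx.
have [ax|ax|//] := IHb x xin oa (ordinal_elt ob xin).
  by case: nab; apply: ordinal_trans ax.
by rewrite -ax in xin.
Qed.

Lemma elts_ole {a x : V} : ordinal a -> elts a x -> ole x a.
Proof. by move=> [tra _] /tra. Qed.

Lemma ole_or_elt {a b : V} : ordinal a -> ordinal b -> ole a b \/ elts a b.
Proof.
move=> oa ob; have [ba|->|] := ordinal_trichotomy oa ob; last by right.
  by left; apply: elts_ole.
by left.
Qed.

Lemma ole_elt_or_eq {a b : V} :
  ordinal a -> ordinal b -> ole a b -> elts b a \/ a = b.
Proof.
move=> oa ob ab; have [|->|/ab/elts_irr //] := ordinal_trichotomy oa ob.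
  by left.
by right.
Qed.

Lemma least_ordinal (A : set V) :
  (forall x, A x -> ordinal x) -> A !=set0 -> exists b, is_least A b.
Proof.
move=> oA /elts_minimal[m Am mmin]; exists m; split=> // x Ax.
by have [//|/mmin] := ole_or_elt (oA m Am) (oA x Ax).
Qed.

(** As [osup] is a [get], it has its intended meaning only once an upper bound exists; [s] is that
    bound. *)
Lemma osup_least (A : set V) (s : V) :
  ordinal s -> (forall x, A x -> ole x s) ->
  is_least [set s | ordinal s /\ forall x, A x -> ole x s] (osup A).
Proof.
move=> os As; apply: getPex; apply: least_ordinal; first by move=> x [].
by exists s.
Qed.

Lemma osup_elts_ub {g : V} (A : set V) : ordinal g ->
  [/\ ordinal (osup (A `&` elts g)), ole (osup (A `&` elts g)) g &
      forall x, A x -> elts g x -> ole x (osup (A `&` elts g))].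
Proof.
move=> og; have ub x : (A `&` elts g) x -> ole x g.
  by move=> [_]; apply: elts_ole.
have [[os sub] sleast] := osup_least _ g og ub.
by split=> // [|x Ax gx]; [apply: sleast | apply: sub].
Qed.

Lemma osup_elts_le {g s : V} (A : set V) : ordinal g -> ordinal s ->
  (forall x, A x -> elts g x -> ole x s) -> ole (osup (A `&` elts g)) s.
Proof.
move=> og os As; have ub x : (A `&` elts g) x -> ole x s by case; apply: As.
by have [_] := osup_least _ s os ub; apply.
Qed.

(** Otherwise [x] would bound [A] below [g], so the supremum would be at most its own element
    [x]. *)
Lemma osup_elts_cofinal {A : set V} {g x : V} : ordinal g ->
  elts (osup (A `&` elts g)) x -> exists y, [/\ A y, elts g y & elts y x].
Proof.
move=> og xs; apply: contrapT => H.
have [_ sg _] := osup_elts_ub A og.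
have ox := ordinal_elt og (sg x xs).
apply: (elts_irr x); apply: osup_elts_le xs => // y Ay gy.
have [//|yx] := ole_or_elt (ordinal_elt og gy) ox.
by case: H; exists y.
Qed.

Lemma limP (A : set V) (g : V) : limit_ordinal g ->
  lim A g <-> forall x, elts g x -> exists y, [/\ A y, elts g y & elts y x].
Proof.
move=> lg; have [og _ _] := lg; split=> [[_ eg] x gx|H].
  by apply: osup_elts_cofinal => //; rewrite eg.
split=> //; have [os sg ub] := osup_elts_ub A og.
apply: Defs.extensionality; apply/seteqP; split=> // x /H[y [Ay gy yx]].
exact: ub yx.
Qed.

(** * Successor ordinals *)

Definition osucc (x : V) : V :=
  let: Tree T f := repr x in
  vset (fun o : option T => if o is Some i then \pi_V (f i) else x).

Lemma elts_osucc x : elts (osucc x) = elts x `|` [set x].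
Proof.
rewrite /osucc /elts -/(elts _); case: (repr x) => T f.
rewrite -/(elts _) elts_vset; apply/seteqP; split=> y.
  by case=> -[i|] _ <-; [left; exists i | right].
by case=> [[i _ <-]|->]; [exists (Some i) | exists None].
Qed.

Lemma osucc_self x : elts (osucc x) x.
Proof. by rewrite elts_osucc; right. Qed.

Lemma osuccW {x y : V} : elts x y -> elts (osucc x) y.
Proof. by rewrite elts_osucc; left. Qed.

Lemma ordinal_osucc x : ordinal x -> ordinal (osucc x).
Proof.
move=> ox; split=> [y|y z]; rewrite elts_osucc.
  by case=> [xy z yz|-> z xz]; left => //; apply: ordinal_trans yz.
case=> [xy|->]; case=> [xz|->].
- exact: ox.2.
- by constructor 1.
- by constructor 3.
- by constructor 2.
Qed.

Lemma limit_neq_osucc {g x : V} : limit_ordinal g -> g <> osucc x.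
Proof.
move=> [_ _ lg] gx; rewrite gx in lg; have [y] := lg x (osucc_self x).
by rewrite elts_osucc => -[xy /(elts_asym _ _ xy)|-> /elts_irr].
Qed.

Lemma osucc_inj x y : osucc x = osucc y -> x = y.
Proof.
move=> xy; have := osucc_self x; rewrite xy elts_osucc => -[yx|//].
have := osucc_self y; rewrite -xy elts_osucc => -[/(elts_asym _ _ yx)|//].
by [].
Qed.

(** * The cardinals [omega1] and [omega2] *)

(** The elements of [A] live in a larger universe than the index types of trees, so the new set is
    indexed by the values in [T] of an injection, decoded by choice. *)
Lemma replacement (T : Type) (A : set V) :
  A #<= [set: T] -> exists o, elts o = A.
Proof.
move=> /card_leP[h].
exists (vset (fun p : {t : T | exists a : A, \val (h a) = t} =>
  \val (projT1 (cid (svalP p))))).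
rewrite elts_vset; apply/seteqP; split=> [_ [p _ <-]|a Aa].
  exact: set_valP.
pose a' : A := SigSub (mem_set Aa).
have H : exists a : A, \val (h a) = \val (h a') by exists a'.
exists (exist (fun t => exists a : A, \val (h a) = t) _ H) => //=.
case: cid => b /= hb.
have /(@inj _ _ _ h) -> // : h b = h a' by apply: val_inj.
- by rewrite inE.
- by rewrite inE.
Qed.

Lemma elts_replacement (A : set V) x : A #<= elts x -> exists o, elts o = A.
Proof.
rewrite /elts; case: (repr x) => T f Ax.
by apply: (replacement T); apply: card_le_trans Ax (card_image_le _ _).
Qed.

(** Burali-Forti: such an injection would make [o] an ordinal belonging to itself. *)
Lemma hartogs {T : Type} {B : set T} {o : V} :
  elts o = [set a | ordinal a /\ elts a #<= B] -> ~ (elts o #<= B).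
Proof.
move=> eo oB; apply: (elts_irr o); rewrite {1}eo; split=> //.
split=> [x|x y]; rewrite eo => -[ox cx].
  move=> y xy; split; first exact: ordinal_elt xy.
  exact: card_le_trans (subset_card_le (elts_ole ox xy)) cx.
by move=> [oy _]; apply: ordinal_trichotomy.
Qed.

Lemma omega1_uncountable : ~ countable omega1.
Proof.
move=> c1; have [o eo] := replacement _ _ c1.
by apply: (hartogs eo); rewrite eo.
Qed.

Lemma omega2_elt {a x} : omega2 a -> elts a x -> omega2 x.
Proof.
move=> [oa ca] ax; split; first exact: ordinal_elt ax.
exact: card_le_trans (subset_card_le (elts_ole oa ax)) ca.
Qed.

Lemma omega2_ole {a b} : ordinal a -> omega2 b -> ole a b -> omega2 a.
Proof.
move=> oa [_ cb] ab; split=> //.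
exact: card_le_trans (subset_card_le ab) cb.
Qed.

Lemma omega1_osucc a : omega1 a -> omega1 (osucc a).
Proof.
move=> [oa ca]; split; first exact: ordinal_osucc.
rewrite elts_osucc -bigcup2E; apply: bigcup_countable; first exact: countableP.
by move=> [|[|i]] _ //=.
Qed.

(* An injection of [elts a] into [omega1], followed by the successor, leaves [0]
   free for the new element [a]. *)
Lemma omega2_osucc a : omega2 a -> omega2 (osucc a).
Proof.
move=> [oa /pcard_leP[f]]; split; first exact: ordinal_osucc.
have emp x : ~ elts vempty x by rewrite elts_vset => -[[]].
pose g y := if y == a then vempty else osucc (f y).
have ginj : {in elts (osucc a) &, injective g}.
  move=> x y; rewrite !inE elts_osucc /g => ax ay.
  case: eqP ax => [->|xa]; case: eqP ay => [->|ya] // ay ax.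
  - by move=> e; case: (emp (f y)); rewrite e; apply: osucc_self.
  - by move=> e; case: (emp (f x)); rewrite -e; apply: osucc_self.
  - move=> /osucc_inj; case: ax => // ax; case: ay => // ay.
    by apply: (@inj _ _ _ f); rewrite inE.
have /card_eqPle[_ /card_le_trans] := inj_card_eq ginj; apply.
apply: subset_card_le => _ [y + <-]; rewrite /g elts_osucc.
case: eqP => [_ _|ya].
  split; first by split=> [x /emp|x z /emp].
  by rewrite (_ : elts _ = set0) // -subset0 => x /emp.
by case=> // ay; apply: omega1_osucc; apply: funS.
Qed.

(** The transitive closure of an ordinal stays inside it, and an injection of [omega2] into [a]
    would give one into [omega1], against [hartogs]. *)
Lemma omega2_Homega2 a : omega2 a -> Homega2 a.
Proof.
move=> a2; have [oa ca] := a2.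
have sub : trcl a `<=` elts a.
  by move=> x tx; apply: tx; split=> //; apply: oa.1.
split.
  by apply: subset_card_le => x /sub/(omega2_elt a2).
move=> /card_le_trans/(_ (subset_card_le sub)) le2.
have [o eo] := elts_replacement _ _ le2.
by apply: (hartogs eo); rewrite eo; apply: card_le_trans ca.
Qed.

Lemma Homega2_elt {x z : V} : Homega2 x -> elts x z -> Homega2 z.
Proof.
move=> [xle2 nlt] xz; have sub : trcl z `<=` trcl x.
  move=> t tz A [trA xA]; apply: tz; split=> // u.
  by apply: trA; apply: xA.
split; first exact: card_le_trans (subset_card_le sub) xle2.
by move=> le2; apply: nlt; apply: card_le_trans le2 (subset_card_le sub).
Qed.

(** Otherwise the part of [A] below [b] would be a countable cofinal set. *)
Lemma cofinality_omega1_lim {A : set V} {b : V} :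
  countable A -> cofinality_omega1 b -> ~ lim A b.
Proof.
move=> cA [_ cofb] Ab; have [lb _] := Ab; have [ob _ _] := lb.
apply: omega1_uncountable; apply: (sub_countable _ cA).
apply: card_le_trans (cofb (A `&` elts b) _) (subset_card_le (@subIsetl _ _ _)).
split; first by move=> x [].
move=> x /(proj1 (limP A b lb) Ab)[y [Ay b_y yx]]; exists y => //.
by apply: elts_ole yx; apply: ordinal_elt b_y.
Qed.

(** * Closure of [XX] under successor *)

(* [v_0] is the successor of [v_1]; [x] and [a] are the indices of [v_0] and
   [v_1] under one more quantifier. *)
Definition succ_formula : formula 2 :=
  let x := lift ord0 ord0 in let a := lift ord0 (lift ord0 ord0) in
  Fand (Fin (lift ord0 ord0) ord0)
    (Fand
      (Fnot (Fex (Fand (Fin ord0 x)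
                       (Fand (Fnot (Fin ord0 a)) (Fnot (Feq ord0 a))))))
      (Fnot (Fex (Fand (Fin ord0 a) (Fnot (Fin ord0 x)))))).

Lemma env_cons0 n x (e : 'I_n -> V) : env_cons x e ord0 = x.
Proof. by rewrite /env_cons unlift_none. Qed.

Lemma env_cons_lift n x (e : 'I_n -> V) i : env_cons x e (lift ord0 i) = e i.
Proof. by rewrite /env_cons liftK. Qed.

(** Quantifiers range over [Homega2] only, but this class is transitive, so they see every element
    of [x] and of [e ord0]. *)
Lemma sat_succ_formula pi Y (e : 'I_1 -> V) x :
  Homega2 x -> Homega2 (e ord0) ->
  sat pi Y succ_formula (env_cons x e) <-> x = osucc (e ord0).
Proof.
move=> Hx He /=; rewrite !env_cons_lift env_cons0.
split=> [[xe [H1 H2]]|->].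
  apply: Defs.extensionality; rewrite elts_osucc.
  apply/seteqP; split=> [z xz|z [ez|-> //]].
    apply: contrapT => nz; apply: H1; exists z; first exact: Homega2_elt xz.
    rewrite !(env_cons_lift, env_cons0).
    by split=> //; split=> ?; apply: nz; [left | right].
  apply: contrapT => nz; apply: H2; exists z; first exact: Homega2_elt ez.
  by rewrite !(env_cons_lift, env_cons0).
rewrite elts_osucc; split; first by right.
split=> -[z _]; rewrite !(env_cons_lift, env_cons0) elts_osucc.
  by case=> -[|] // ? [].
by move=> [ez]; apply; left.
Qed.

(** The successor is the only witness of [succ_formula], so any Skolem function for that formula
    must return it. *)
Lemma XX_osucc (pi : V -> V) {Y F M x} : definable_skolem_functions pi Y F ->
  XX F Y M -> M `<=` omega2 -> M x -> M (osucc x).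
Proof.
move=> [Fdef Fsk] [_ SkM _] M2 Mx.
have x2 := omega2_osucc _ (M2 x Mx).
have [f Ff fsk] := Fsk 1%N succ_formula.
pose e (i : 'I_1) := x.
have He : in_Homega2 e by move=> i; apply: omega2_Homega2; apply: M2.
have Hfe := (Fdef _ _ Ff).1 e He.
have fe : f e = osucc x.
  apply: (proj1 (sat_succ_formula pi Y e (f e) Hfe (He ord0))).
  apply: fsk => //; exists (osucc x); first exact: omega2_Homega2.
  by apply/sat_succ_formula => //; apply: omega2_Homega2.
rewrite -SkM -fe; split; last by rewrite fe.
by move=> B [clB MB]; apply: clB => // i; apply: MB.
Qed.

(** * Countable subsets of [omega2] *)

(* If [A] were cofinal, then the successors of its elements together with their
   limit points would form a club consisting of ordinals that are not limits or
   have countable cofinality. *)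
Lemma countable_bounded {F : fun_family} {Gamma : set V} {A : set V} :
  Gamma `<=` Lambda F -> stationary Gamma -> A `<=` omega2 -> countable A ->
  exists2 c, omega2 c & forall a, A a -> ole a c.
Proof.
move=> GL Gst A2 cA; apply: contrapT => nb.
have unb c : omega2 c -> exists2 a, A a & elts a c.
  move=> c2; apply: contrapT => na; apply: nb; exists c => // a Aa.
  by have [//|ac] := ole_or_elt (A2 a Aa).1 c2.1; case: na; exists a.
pose S := osucc @` A.
have [|b [Gb Db]] := Gst (S `|` [set g | omega2 g /\ lim S g]).
  split=> [_ [[a Aa <-]|[]//]|c /unb[a Aa ac]|g g2 limg].
  - by apply: omega2_osucc; apply: A2.
  - by exists (osucc a); [left; exists a | apply: osuccW].
  (* A limit of limit points of [S] is a limit point of [S]: an element [d] above [x] is in [S] or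
     has elements of [S] between [x] and itself. *)
  - right; split=> //; have [lg _] := limg; apply/(limP _ _ lg) => x gx.
    have [d [Dd gd dx]] := proj1 (limP _ _ lg) limg x gx.
    have [Sd|[_ limd]] := Dd; first by exists d.
    have [ld _] := limd; have [y [Sy dy yx]] := proj1 (limP _ _ ld) limd x dx.
    by exists y; split=> //; apply: ordinal_trans dy => //; case: lg.
have [_ cofb [lb _]] := GL b Gb.
case: Db => [[a _ ab]|[_ limb]]; last first.
  by apply: (cofinality_omega1_lim _ cofb limb); apply: sub_countable cA;
     apply: card_image_le.
by apply: (limit_neq_osucc lb); rewrite -ab.
Qed.

(** The ordinals above [a] form a club, unbounded because the successor of the larger of [a] and [c]
    is above both. *)
Lemma stationary_unbounded {S : set V} {a : V} :
  stationary S -> omega2 a -> exists2 b, S b & elts b a.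
Proof.
move=> Sst a2; have [|b [Sb [_ ba]]] := Sst [set b | omega2 b /\ elts b a].
  split=> [b []//|c c2|g g2 limg].
    have [ac|ca] := ole_or_elt a2.1 c2.1.
      exists (osucc c); last exact: osucc_self.
      split; first exact: omega2_osucc.
      have [ca|->] := ole_elt_or_eq a2.1 c2.1 ac; last exact: osucc_self.
      exact: osuccW.
    exists (osucc a); last exact: osuccW.
    by split; [apply: omega2_osucc | apply: osucc_self].
  split=> //; have [lg _] := limg; have [og [x gx] _] := lg.
  have [d [[_ da] gd _]] := proj1 (limP _ _ lg) limg x gx.
  exact: ordinal_trans da.
by exists b.
Qed.

(** * Comparison points *)

Section ComparisonPoint.

Context {F : fun_family} {Gamma : set V}.
Hypotheses (Gamma_Lambda : Gamma `<=` Lambda F) (Gamma_st : stationary Gamma).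

Lemma Gamma_omega2 {b} : Gamma b -> omega2 b.
Proof. by move=> /Gamma_Lambda[]. Qed.

Lemma Gamma_least_above {g} : omega2 g ->
  exists2 b, is_least (Gamma `\` elts g) b & ole g b.
Proof.
move=> g2; have [|//|b lb] := least_ordinal (Gamma `\` elts g).
- by move=> x [/Gamma_omega2[]].
- have [b Gb bg] := stationary_unbounded Gamma_st g2.
  by exists b; split=> // /(elts_asym _ _ bg).
exists b => //; have [[Gb ngb] _] := lb.
by have [//|] := ole_or_elt g2.1 (Gamma_omega2 Gb).1.
Qed.

(** No point of [Gamma] lies in [g, b), hence none lies in the smaller interval that starts at the
    supremum of [M] below [b]. *)
Lemma Gamma_at_least {M : set V} {g b} : is_least (Gamma `\` elts g) b ->
  ole g (osup (M `&` elts b)) -> Gamma_at Gamma M b.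
Proof.
move=> [[Gb ngb] bleast] gs; split=> //.
have [_ sb _] := osup_elts_ub M (Gamma_omega2 Gb).1.
split; first by split=> // /sb/elts_irr.
by move=> x [Gx nsx]; apply: bleast; split=> // /gs.
Qed.

(** If [M] had no point between [s] and [t], then [s] would itself be a point of [Gamma] at or above
    the supremum of [M] below [t], against the minimality of [t]. *)
Lemma Gamma_at_between {M : set V} {s t} : Gamma_at Gamma M s ->
  Gamma_at Gamma M t -> elts t s -> exists m, [/\ M m, elts t m & elts m s].
Proof.
move=> [Gs _] [Gt [_ tleast]] ts.
apply: (osup_elts_cofinal (Gamma_omega2 Gt).1); apply: contrapT => ns.
by apply: (elts_irr s); apply: (tleast s).
Qed.

Lemma comparison_pointP (M N : set V) : M `<=` omega2 -> countable M ->
  is_greatest (Gamma_at Gamma M `&` Gamma_at Gamma N)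
    (comparison_point Gamma M N).
Proof.
move=> M2 cM; set S := _ `&` _; rewrite /comparison_point -/S.
suff: exists b, is_greatest S b by move=> /getPex.
apply: contrapT => nogr.
have oS s : S s -> ordinal s by move=> [[/Gamma_omega2[]]].
have next s : S s -> exists2 t, S t & elts t s.
  move=> Ss; apply: contrapT => nt; apply: nogr; exists s; split=> // t St.
  by have [//|ts] := ole_or_elt (oS t St) (oS s Ss); case: nt; exists t.
have [c c2 Mc] := countable_bounded Gamma_Lambda Gamma_st M2 cM.
(* A point of [M] lies above each [s] in [S], so a bound for [M] also bounds [S] and keeps its
   supremum in [omega2]. *)
have Sc s : S s -> ole s c.
  move=> Ss; have [t St ts] := next s Ss.
  have [m [Mm _ ms]] := Gamma_at_between Ss.1 St.1 ts.
  by apply: elts_ole c2.1 _; apply: Mc ms.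
have [[og gub] gleast] := osup_least S c c2.1 Sc.
have g2 : omega2 (osup S).
  by apply: (omega2_ole og c2); apply: gleast; split=> //; apply: c2.1.
have [b lb gb] := Gamma_least_above g2.
have ob := (Gamma_omega2 lb.1.1).1.
(* Points of [L] interleave with [S], so the supremum of [S] is at most that of [L] below [b]; this
   serves for both [M] and [N]. *)
have at_b L : S `<=` Gamma_at Gamma L -> Gamma_at Gamma L b.
  move=> SL; apply: (Gamma_at_least lb).
  have [os _ ub] := osup_elts_ub L ob.
  apply: gleast; split=> // s Ss; have [t St ts] := next s Ss.
  have [m [Lm tm ms]] := Gamma_at_between (SL s Ss) (SL t St) ts.
  have bm : elts b m by apply: gb; apply: (gub t).
  move=> x sx; apply: (ub m Lm bm).
  exact: ordinal_trans (ordinal_elt ob bm) ms sx.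
apply: nogr; exists b; split; first by split; apply: at_b => x [].
by move=> s Ss x sx; apply: gb; apply: (gub s).
Qed.

(** The definition of [lim] does not confine limit points to [omega2]; a bound for the countable set
    [M] does. *)
Lemma limit_point_omega2 {M : set V} {g} : M `<=` omega2 -> countable M ->
  (M `|` lim M) g -> omega2 g.
Proof.
move=> M2 cM [/M2//|[[og _ _] eg]].
have [c c2 Mc] := countable_bounded Gamma_Lambda Gamma_st M2 cM.
apply: (omega2_ole og c2); rewrite -eg.
by apply: (osup_elts_le M og c2.1) => x Mx _; apply: Mc.
Qed.

(** Whether [g] is in [M] or is a limit of it, the supremum of [M] below [b] is at least [g]. *)
Lemma Gamma_at_above {M : set V} {g b} : (M `|` lim M) g ->
  is_least (Gamma `\` elts g) b -> elts b g -> Gamma_at Gamma M b.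
Proof.
move=> Mg lb bg; apply: (Gamma_at_least lb).
have ob := (Gamma_omega2 lb.1.1).1.
have [os _ ub] := osup_elts_ub M ob.
case: Mg => [Mg|[[og _ _] eg]]; first exact: ub.
rewrite -{1}eg; apply: (osup_elts_le M og os) => x Mx gx.
by apply: ub => //; apply: ordinal_trans gx.
Qed.

End ComparisonPoint.

Theorem proposition2p6
  (two_omega1 : [set A : set V | A `<=` omega1] #= omega2)
  (pi : V -> V) (pi_bij : set_bij omega2 Homega2 pi)
  (Y : set (set V)) (Y_stationary : Pstationary Y) (Y_thin : thin Y)
  (Y_initial : initial_segment_closed Y)
  (F : fun_family) (F_skolem : definable_skolem_functions pi Y F)
  (Gamma : set V) (Gamma_Lambda : Gamma `<=` Lambda F)
  (Gamma_stationary : stationary Gamma)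
  (M N : set V) (M_XX : XX F Y M) (N_XX : XX F Y N) :
  (M `|` lim M) `&` (N `|` lim N) `<=` elts (comparison_point Gamma M N).
Proof.
have [YM _ _] := M_XX; have [YN _ _] := N_XX.
have [M2 cM] := Y_stationary.1 M YM; have [N2 cN] := Y_stationary.1 N YN.
have [[[Gc _] _] cmax] :=
  comparison_pointP Gamma_Lambda Gamma_stationary M N M2 cM.
set c := comparison_point Gamma M N in Gc cmax *.
have limG L g : countable L -> lim L g -> ~ Gamma g.
  by move=> cL limg /Gamma_Lambda[_ cofg _]; apply: cofinality_omega1_lim limg.
(* As [g] is not in [Gamma], the least point [b] of [Gamma] from [g] on is strictly above [g]; it is
   a common comparison point, so at most [c]. *)
have main g : omega2 g -> (M `|` lim M) g -> (N `|` lim N) g -> ~ Gamma g ->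
    elts c g.
  move=> g2 Mg Ng nGg.
  have [b lb gb] := Gamma_least_above Gamma_Lambda Gamma_stationary g2.
  have Gb := lb.1.1; have [b2 _ _] := Gamma_Lambda b Gb.
  have bg : elts b g.
    have [//|eg] := ole_elt_or_eq g2.1 b2.1 gb.
    by case: nGg; rewrite eg.
  by apply: (cmax b) => //; split; apply: (Gamma_at_above Gamma_Lambda _ lb bg).
move=> g [Mg Ng].
have g2 : omega2 g.
  exact: (limit_point_omega2 Gamma_Lambda Gamma_stationary M2 cM Mg).
case: (Mg) => [Mg'|limg]; last by apply: main => //; apply: limG limg.
case: (Ng) => [Ng'|limg]; last by apply: main => //; apply: limG limg.
(* Here [g] is in both [M] and [N] and may belong to [Gamma]; its successor cannot, since points of
   [Gamma] are limits. *)
have [c2 _ _] := Gamma_Lambda c Gc.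
apply: (ordinal_trans c2.1) (osucc_self g); apply: main.
- exact: omega2_osucc.
- by left; apply: (XX_osucc pi F_skolem M_XX).
- by left; apply: (XX_osucc pi F_skolem N_XX).
- by move=> /Gamma_Lambda[_ _ [lg _]]; apply: (limit_neq_osucc lg).
Qed.
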